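(* For every integer $n\geq 5$, $f(n,2)\geq T(n-4)$, where $T(1)=2$ and $T(k+1)=2^{T(k)}$ (a tower of $n-4$ twos).
   Context: A word over an alphabet is a finite string of letters; a subword of $w$ is a string of consecutive letters of $w$. A word $w$ contains a pattern $P$ if there is a map assigning to each letter of $P$ a nonempty word (different letters may receive equal words) such that the word obtained from $P$ by replacing each letter by its assigned word is a subword of $w$; otherwise $w$ avoids $P$. The Zimin words are defined by $Z_1=x_1$ and $Z_n=Z_{n-1}x_nZ_{n-1}$, where $x_n$ is a new letter. For positive integers $n,q$, $f(n,q)$ denotes the smallest integer such that every word of length $f(n,q)$ over an alphabet of size $q$ contains $Z_n$. *)

(* Defs.v *)
From mathcomp Require Import all_boot.
From mathcomp Require Import boolp.

Set Implicit Arguments.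
Unset Strict Implicit.
Unset Printing Implicit Defensive.

(* [infix u w]: u occurs in w as a block of consecutive letters. *)
Definition contains (X A : eqType) (w : seq A) (P : seq X) : Prop :=
  exists h : X -> seq A,
    (forall x, x \in P -> h x != [::]) /\ infix (flatten (map h P)) w.

(* The letter x_i is the natural number i; Z_0 is the empty word by convention,
   so that Z_1 = x_1. *)
Fixpoint zimin (n : nat) : seq nat :=
  if n is k.+1 then zimin k ++ n :: zimin k else [::].

Lemma mem_zimin n x : x \in zimin n -> x <= n.
Proof.
elim: n => [|n IHn] //=; rewrite mem_cat inE.
by case/or3P=> [/IHn/leqW | /eqP-> | /IHn/leqW].
Qed.

Lemma contains_zimin_step (A : eqType) n (p u c s : seq A) :
  c != [::] -> contains u (zimin n) ->
  contains (p ++ u ++ c ++ u ++ s) (zimin n.+1).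
Proof.
move=> c0 [h [h0 /infixP[a [b def_u]]]].
pose h' x := if x == n.+1 then b ++ c ++ a else h x.
have h'E : {in zimin n, h' =1 h}.
  move=> x /mem_zimin lexn; rewrite /h'.
  by case: eqP lexn => // ->; rewrite ltnn.
have h'n : h' n.+1 = b ++ c ++ a by rewrite /h' eqxx.
exists h'; split=> [x|] /=.
  rewrite mem_cat inE => /or3P[xn | /eqP-> | xn]; first 1 [by rewrite h'E ?h0].
    by rewrite h'n; case: (b) c0 => //=; case: (c).
  by rewrite h'E ?h0.
rewrite map_cat flatten_cat /= h'n; move/eq_in_map: h'E => ->.
apply/infixP; exists (p ++ a), (b ++ s).
by rewrite def_u -!catA.
Qed.

Lemma zimin_unavoidable n q :
  exists m, `[< forall w : m.-tuple 'I_q, contains w (zimin n) >].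
Proof.
suff [m Hm] : exists m, forall w : m.-tuple 'I_q, contains w (zimin n).
  by exists m; apply/asboolP.
elim: n => [|n [m IHm]].
  by exists 0 => w; exists (fun=> [::]); split; rewrite ?infix0s.
pose N := #|{: m.-tuple 'I_q}|.+1.
exists (N * m.+1) => w.
pose blk (i : nat) := take m (drop (i * m.+1) w).
have le_blk (i : 'I_N) : i * m.+1 + m.+1 <= N * m.+1.
  by rewrite addnC -mulSn leq_mul2r ltn_ord.
have sz_blk (i : 'I_N) : size (blk i) == m.
  rewrite size_take_min size_drop size_tuple; apply/eqP/minn_idPl.
  by rewrite leq_subRL ?(leq_trans _ (le_blk i)) ?leq_addr // leq_add2l.
pose F (i : 'I_N) : m.-tuple 'I_q := Tuple (sz_blk i).
have [i [j [ltij eqF]]] : exists i j : 'I_N, i < j /\ F i = F j.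
  have /injectivePn[i [j neq eqF]] : ~~ injectiveb F.
    apply/negP=> /injectiveP/leq_card; rewrite card_ord.
    by rewrite /N ltnn.
  case: (ltngtP i j) => [lt|lt|/val_inj eq].
  - by exists i, j.
  - by exists j, i.
  - by rewrite eq eqxx in neq.
have eqb : blk i = blk j by have := congr1 val eqF.
pose c := take (j * m.+1 - (i * m.+1 + m)) (drop (i * m.+1 + m) w).
have lt_ij : i * m.+1 + m < j * m.+1.
  by rewrite -addnS addnC -mulSn leq_mul2r ltij orbT.
have lt_jw : j * m.+1 < N * m.+1 by rewrite ltn_mul2r ltn_ord.
have -> : val w = take (i * m.+1) w ++ blk i ++ c ++ blk i
                  ++ drop m (drop (j * m.+1) w).
  rewrite {2}eqb /blk cat_take_drop.
  have -> : drop (j * m.+1) w =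
     drop (j * m.+1 - (i * m.+1 + m)) (drop (i * m.+1 + m) w).
    by rewrite drop_drop subnK // ltnW.
  by rewrite /c cat_take_drop addnC -drop_drop !cat_take_drop.
apply: contains_zimin_step; last exact: (IHm (F i)).
rewrite -size_eq0 size_take_min size_drop size_tuple -lt0n leq_min !subn_gt0.
by rewrite lt_ij (ltn_trans lt_ij).
Qed.

(* f(n,q): the least m such that every word of length m over an alphabet of
   size q contains Z_n. *)
Definition zimin_f (n q : nat) : nat := ex_minn (zimin_unavoidable n q).

Lemma zimin_f_spec n q :
  (forall w : (zimin_f n q).-tuple 'I_q, contains w (zimin n)) /\
  (forall m, (forall w : m.-tuple 'I_q, contains w (zimin n)) -> zimin_f n q <= m).
Proof.
rewrite /zimin_f; case: ex_minnP => m /asboolP Hm min_m; split=> // k Hk.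
by apply: min_m; apply/asboolP.
Qed.

(* A tower of k twos; the empty tower is 1, so that tower 1 = 2. *)
Fixpoint tower (k : nat) : nat := if k is j.+1 then 2 ^ tower j else 1.

(* Main.v *)
Require Import Defs.
From mathcomp Require Import all_boot.
From mathcomp Require Import zify.

(* Idea: an odometer word.  Level-0 blocks are the letters 0, ..., 31; a block
   of level k+1 lists all the blocks of level k in a fixed order, separated by
   one-bit separators, and is determined by these bits.  The top level provides
   a tower-type length.  Since level-k blocks synchronise, if XYX lies within
   two consecutive blocks of level k+1 then X lies within two consecutive blocks
   of level k: otherwise X would contain a level-k block with both neighbouring
   separators, which occurs again only at the same place of the next level-(k+1)
   block, and there one of the two separators differs because every other
   separator alternates from one block to the next.  Each level hence costs one
   Zimin index.  Finally the 64 letters are encoded by synchronising binary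
   blocks of length 15; as X_5 is replaced by a word of length at least 31,
   which contains a full block, this costs only four more indices. *)

(** * Binary expansions and occurrences of Zimin words by position *)

Lemma eq_mod_bits n x y :
  (forall u, u < n -> odd (x %/ 2 ^ u) = odd (y %/ 2 ^ u)) ->
  x = y %[mod 2 ^ n].
Proof.
elim: n x y => [|n IHn] x y eq_xy; first by rewrite !modn1.
have /IHn eq_half u : u < n -> odd (x./2 %/ 2 ^ u) = odd (y./2 %/ 2 ^ u).
  by move=> ltun; rewrite -!divn2 -!divnMA -expnS eq_xy.
have eq_odd : odd x = odd y by have := eq_xy 0 isT; rewrite !divn1.
have modE z : z %% 2 ^ n.+1 = odd z + (z./2 %% 2 ^ n) * 2.
  rewrite {1}(divn_eq z 2) modn2 divn2 addnC expnSr.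
  rewrite {1}(divn_eq z./2 (2 ^ n)) mulnDl -mulnA addnCA modnMDl modn_small //.
  have : z./2 %% 2 ^ n < 2 ^ n by rewrite ltn_pmod ?expn_gt0.
  by case: (odd z); lia.
by rewrite !modE eq_odd eq_half.
Qed.

(* The factor of s of length l at position a is an image of Z_n; d is the
   distance between the two copies of the image of Z_(n-1). *)
Fixpoint zimin_at {T : Type} (s : nat -> T) (n a l : nat) : Prop :=
  if n is k.+1 then
    exists l' d, [/\ l' < d, l = d + l', zimin_at s k a l'
                   & forall r, r < l' -> s (a + r) = s (a + d + r)]
  else l = 0.

Lemma zimin_at_size {T} {s : nat -> T} {n a l} :
  zimin_at s n a l -> 2 ^ n <= l.+1.
Proof.
elim: n l => [|n IHn] l //= [l' [d [lt_l'd -> /IHn le_l' _]]].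
rewrite expnS; lia.
Qed.

Lemma zimin_at_image (X : eqType) (h : nat -> seq X) (s : nat -> X) x0 n a :
  (forall x, x \in zimin n -> h x != [::]) ->
  let w := flatten (map h (zimin n)) in
  (forall r, r < size w -> nth x0 w r = s (a + r)) -> zimin_at s n a (size w).
Proof.
elim: n => [|n IHn] //= h0.
rewrite map_cat flatten_cat /=; set w := flatten _; set v := h n.+1 => ws.
have v0 : 0 < size v.
  by rewrite lt0n size_eq0 h0 // mem_cat inE eqxx orbT.
have ws1 r : r < size w -> nth x0 w r = s (a + r).
  move=> ltr; rewrite -ws ?size_cat; last by lia.
  by rewrite nth_cat ltr.
have ws2 r : r < size w -> nth x0 w r = s (a + (size w + size v) + r).
  move=> ltr; rewrite -addnA -ws ?size_cat; last by lia.
  rewrite nth_cat ifN; last by lia.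
  rewrite nth_cat ifN; last by lia.
  by congr nth; lia.
exists (size w), (size w + size v); split; first by lia.
- by rewrite !size_cat; lia.
- by apply: IHn => // x xn; rewrite h0 // mem_cat xn.
- by move=> r ltr; rewrite -ws1 // -ws2.
Qed.

Lemma contains_mkseq {X : eqType} {s : nat -> X} {n m} :
  contains (mkseq s m) (zimin n) ->
  exists a l, a + l <= m /\ zimin_at s n a l.
Proof.
case=> h [h0 /infixP[u [v def_s]]]; set w := flatten _ in def_s.
have sz : size u + size w + size v = m.
  by rewrite -(size_mkseq s m) def_s !size_cat addnA.
exists (size u), (size w); split; first by lia.
apply: (@zimin_at_image _ _ _ (s 0)) => // r; rewrite -/w => ltr.
rewrite -(nth_mkseq (s 0) s (n := m) (i := size u + r)); last by lia.
by rewrite def_s nth_cat ifN ?addKn ?nth_cat ?ltr //; lia.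
Qed.

(** * The odometer word *)

(* The number of blocks of level k.  Starting with 32 blocks at level 0 makes up
   for the indices lost in the binary encoding. *)
Definition nblocks k := 2 * tower (k + 3).

(* The length of a level-k block, plus one for its separator. *)
Fixpoint period k := if k is j.+1 then period j * nblocks j else 2.

(* The i-th separator (1 <= i) inside block number j: the even ones carry the
   parity of j and so alternate, the odd ones spell the other bits of j. *)
Definition digit j i := odd (j %/ 2 ^ (if odd i then uphalf i else 0)).

(* Separators of level at least k are the positions t with period k %| t.+1. *)
Definition level c := find (fun k => ~~ (period k.+1 %| c)) (iota 0 c).

(** The offset 32 keeps separators distinct from the level-0 blocks at even positions. *)
Definition letter t :=
  let k := level t.+1 in
  if odd t then
    32 + digit (t.+1 %/ period k.+1) ((t.+1 %/ period k) %% nblocks k)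
  else t./2 %% 32.

Lemma tower_gt0 k : 0 < tower k.
Proof. by case: k => //= k; rewrite expn_gt0. Qed.

Lemma nblocks_ge4 k : 4 <= nblocks k.
Proof.
rewrite /nblocks addn3 (leq_mul2l 2 2) (@leq_exp2l 2 1) //.
exact: tower_gt0 k.+2.
Qed.

Lemma nblocksS k : nblocks k.+1 = 2 ^ (nblocks k)./2.+1.
Proof. by rewrite {2}/nblocks mul2n doubleK expnS. Qed.

Lemma period_gt k : k < period k.
Proof.
elim: k => //= k IHk; have := nblocks_ge4 k.
by move: (period k) (nblocks k) IHk => p N; nia.
Qed.

Lemma dvdn_period i j : i <= j -> period i %| period j.
Proof.
elim: j => [|j IHj]; first by rewrite leqn0 => /eqP->.
rewrite leq_eqVlt => /predU1P[-> //|/IHj]; exact: dvdn_mulr.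
Qed.

Lemma letter_lt t : letter t < 64.
Proof.
rewrite /letter; case: odd; first by case: digit.
by have := ltn_pmod t./2 (isT : 0 < 32); lia.
Qed.

Lemma level_eq k c : period k %| c -> ~~ (period k.+1 %| c) -> level c = k.
Proof.
move=> pk pk1.
have c0 : 0 < c by case: c pk1 {pk} => //; rewrite dvdn0.
have ltkc : k < c := leq_trans (period_gt k) (dvdn_leq c0 pk).
have nth_id i : i < c -> nth 0 (iota 0 c) i = i by move=> ?; rewrite nth_iota.
rewrite /level; set P := (X in find X _).
have hasP : has P (iota 0 c).
  by apply/hasP; exists k; rewrite ?mem_iota // /P pk1.
have lt_f : find P (iota 0 c) < c by rewrite -{2}(size_iota 0 c) -has_find.
case: (ltngtP (find P (iota 0 c)) k) => // [ltf|ltf].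
  have := nth_find 0 hasP; rewrite nth_id // {1}/P.
  by rewrite (dvdn_trans (dvdn_period _ _ ltf) pk).
by have := before_find 0 ltf; rewrite nth_id // /P pk1.
Qed.

Lemma letter_sep k c i : 0 < i < nblocks k ->
  letter ((c * nblocks k + i) * period k).-1 = 32 + digit c i.
Proof.
move=> /andP[i0 ltiN].
have p0 : 0 < period k by exact: leq_trans (period_gt k).
have N0 : 0 < nblocks k by exact: leq_trans (nblocks_ge4 k).
set t := (_ * period k).
have t0 : 0 < t by rewrite muln_gt0 p0 addn_gt0 i0 orbT.
have lev : level t = k.
  apply: level_eq; first exact: dvdn_mull.
  rewrite /= [period k * _]mulnC dvdn_pmul2r //.
  rewrite dvdn_addr ?(dvdn_mull c (dvdnn _)) //.
  by rewrite gtnNdvd.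
have ot : odd t.-1.
  have : 2 %| t by rewrite (dvdn_trans (dvdn_period 0 k isT)) ?dvdn_mull.
  by rewrite dvdn2; case: (t) t0 => //= u _; rewrite negbK.
rewrite /letter ot prednK // lev /= divnMA mulnK // divnMDl // modnMDl.
by rewrite divn_small // addn0 modn_small.
Qed.

(** By induction the first sub-block aligns [b]; the separators then spell the bits of [c] that
    determine it modulo the number of blocks. *)
Lemma letter_sync {k c b} :
  (forall r, r < (period k).-1 -> letter (c * period k + r) = letter (b + r)) ->
  exists2 c', b = c' * period k & c = c' %[mod nblocks k].
Proof.
elim: k c b => [|k IHk] c b eq_cb.
  have := eq_cb 0 isT; rewrite !addn0 /letter muln2 odd_double doubleK.
  case: ifP => [ob|eb].
    by have := ltn_pmod c (isT : 0 < 32); lia.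
  move=> eqm; exists b./2 => //; rewrite muln2.
  by have := odd_double_half b; rewrite eb.
have N4 := nblocks_ge4 k; have p1 := period_gt k.
have ltp i r : i.+1 < nblocks k -> r < period k ->
    i * period k + r < (period k.+1).-1.
  rewrite /=; move: (period k) (nblocks k) p1 => p N *; nia.
have [|c1 bE eq_c1] := IHk (c * nblocks k) b.
  move=> r ltr; rewrite -mulnA [nblocks k * _]mulnC eq_cb //.
  have := ltp 0 r; rewrite mul0n; apply; lia.
have /dvdnP[c2 c1E] : nblocks k %| c1 by rewrite /dvdn -eq_c1 modnMl.
exists c2; first by rewrite bE c1E -mulnA [nblocks k * _]mulnC.
rewrite nblocksS; apply: eq_mod_bits => u ltu.
have key i : 0 < i < nblocks k -> digit c i = digit c2 i.
  move=> /andP[i0 ltiN]; have := eq_cb (i * period k).-1.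
  have shift e : e * period k.+1 + (i * period k).-1 =
                 ((e * nblocks k + i) * period k).-1.
    have : 0 < i * period k by rewrite muln_gt0 i0; lia.
    by rewrite mulnDl /= -mulnA [nblocks k * _]mulnC; lia.
  rewrite bE c1E -[_ * _ * period k]mulnA [nblocks k * period k]mulnC.
  rewrite -/(period k.+1) !shift !letter_sep ?i0 //.
  have := ltp i.-1 (period k).-1 ltac:(lia) ltac:(lia).
  have -> : i.-1 * period k + (period k).-1 = (i * period k).-1.
    by case: (i) i0 => // j _ /=; rewrite mulSn; lia.
  by move=> lt /(_ lt); do 2!case: digit.
have evenN : nblocks k = (nblocks k)./2.*2 by rewrite /nblocks mul2n doubleK.
(* Bit 0 is read off separator 2, bit [u.+1] off separator [u.*2.+1]. *)
case: u ltu => [_|u ltu].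
  by have := key 2; rewrite /digit /=; apply; lia.
have := key u.*2.+1; rewrite /digit /= odd_double doubleK.
by apply; lia.
Qed.

(** * Avoidance of Zimin words by the odometer *)

(* At most one position in [a, a + l) holds a separator of level at least k. *)
Definition window k a l :=
  forall c, a < c * period k -> a + l < c.+1 * period k.

Lemma window_step {k a l d} : 0 < d -> window k.+1 a (d + l) ->
  (forall r, r < l -> letter (a + r) = letter (a + d + r)) -> window k a l.
Proof.
move=> d0 win eq_ad c ac; rewrite ltnNge; apply/negP => cal.
have N4 := nblocks_ge4 k; have p1 := period_gt k.
have eq_at t : a <= t -> t < a + l -> letter t = letter (t + d).
  move=> le lt; have := eq_ad (t - a) ltac:(lia).
  by rewrite addnAC subnKC.
have [|c' dE eq_c] := @letter_sync k c (c * period k + d).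
  by move=> r ltr; rewrite eq_at 1?addnAC //; move: cal; rewrite mulSn; lia.
have [j c'E j0] : exists2 j, c' = c + j * nblocks k & 0 < j.
  have le_c : c <= c' by rewrite -(leq_pmul2r (_ : 0 < period k)); lia.
  have /dvdnP[j E] : nblocks k %| c' - c by rewrite -eqn_mod_dvd // eq_c.
  exists j; first by lia.
  case: j E => // E; have cc : c' = c by lia.
  by move: dE; rewrite cc; lia.
have {}dE : d = j * period k.+1.
  by move: dE; rewrite c'E mulnDl /= -mulnA [nblocks k * _]mulnC; lia.
have le_d : period k.+1 <= d by rewrite dE leq_pmull.
pose Q := c %/ nblocks k; pose i := c %% nblocks k.
have cE : c = Q * nblocks k + i := divn_eq _ _.
have ltiN : i < nblocks k by rewrite ltn_pmod; lia.
have cpE e : (c + e) * period k = Q * period k.+1 + (i + e) * period k.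
  by rewrite /= cE -addnA mulnDl [period k * _]mulnC mulnA.
have cp0 := cpE 0; rewrite !addn0 in cp0.
have cp1 := cpE 1; rewrite !addn1 in cp1.
have mulS e : e.+1 * period k.+1 = e * period k.+1 + period k.+1.
  by rewrite mulSn addnC.
have lt_next : i.+1 * period k <= period k.+1.
  by rewrite /= mulnC leq_mul2l ltiN orbT.
(* If [i = 0], a separator of level at least [k.+1] precedes the block and recurs in the window, as
   [d] is a multiple of [period k.+1]; likewise after the block if [i] is last. *)
case: (posnP i) => [i0|i0].
  have := win Q; rewrite mulS; rewrite i0 in cp0 cp1 lt_next; lia.
have ltQ : a < Q.+1 * period k.+1.
  by rewrite mulS; have := leq_mul2r (period k) i i.+1; lia.
have := win _ ltQ; rewrite !mulS => bound.
have [iN|ltiN1] : i.+1 = nblocks k \/ i.+1 < nblocks k by lia.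
  have : i.+1 * period k = period k.+1 by rewrite iN mulnC.
  lia.
have j1 : j = 1.
  move: bound; rewrite dE; case: (j) j0 => // [[//|e]] _.
  by rewrite !mulS; lia.
have dQ e : 0 < i + e < nblocks k -> e <= 1 ->
    digit Q (i + e) = digit Q.+1 (i + e).
  move=> ie le1; have pos : a < (c + e) * period k.
    by rewrite (leq_trans ac) // leq_mul2r leq_addr orbT.
  have le : (c + e) * period k <= c.+1 * period k.
    by rewrite leq_mul2r -addn1 leq_add2l le1 orbT.
  have := eq_at ((c + e) * period k).-1 ltac:(lia) ltac:(lia).
  have -> : ((c + e) * period k).-1 + d =
            ((Q.+1 * nblocks k + (i + e)) * period k).-1.
    have -> : Q.+1 * nblocks k + (i + e) = c + e + nblocks k.
      by rewrite cE; lia.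
    by rewrite [(_ + nblocks k) * _]mulnDl dE j1 /= [period k * _]mulnC; lia.
  rewrite {1}cE -addnA !letter_sep //.
  by do 2!case: digit.
(* One of the separators [i] and [i.+1] is even, so its digit differs between [Q] and [Q.+1]. *)
case oi : (odd i).
  have := dQ 1; rewrite addn1 /digit /= oi /= !divn1 /= => E.
  by have := E ltac:(lia) isT; case: odd.
have := dQ 0; rewrite addn0 /digit oi !divn1 /= => E.
by have := E ltac:(lia) isT; case: odd.
Qed.

Lemma window_avoids {k a l} : window k a l -> ~ zimin_at letter k.+2 a l.
Proof.
elim: k l => [|k IHk] l win [l' [d [lt_l'd lE Zk eq_ad]]]; last first.
  apply: IHk Zk; apply: window_step eq_ad; first by lia.
  by rewrite -lE.
(* At level 0 only three letters fit, the middle one a separator; the outer two are consecutive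
   modulo 32. *)
have sz := @zimin_at_size _ letter 1 a l' Zk.
have l'0 : 0 < l' by lia.
have := win (a./2.+1); rewrite /= => w.
have := odd_double_half a; case oa: (odd a) => aE; first by lia.
have d2 : d = 2 by lia.
have := eq_ad 0 l'0; rewrite d2 !addn0 addn2 /letter [odd a.+2]/= negbK oa.
by rewrite [a.+2./2]/=; lia.
Qed.

(** * Binary encoding and the tower bound *)

(* The code 00 1 b0 1 b1 ... 1 b5 1, in which 00 marks the start of a block. *)
Definition code_bit x r := (1 < r) && (odd r ==> odd (x %/ 2 ^ (r - 3)./2)).

Definition bit t := code_bit (letter (t %/ 15)) (t %% 15).

Lemma bit_block x r : r < 15 -> bit (x * 15 + r) = code_bit (letter x) r.
Proof.
move=> ltr; rewrite /bit divnMDl // modnMDl.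
by rewrite divn_small // modn_small // addn0.
Qed.

(** Past the marker 00 every other bit is 1, including the last. *)
Lemma bit_sync t : ~~ bit t -> ~~ bit t.+1 -> 15 %| t.
Proof.
rewrite (divn_eq t 15); have : t %% 15 < 15 by rewrite ltn_pmod.
move: (t %/ 15) (t %% 15) => x r ltr.
rewrite dvdn_addr ?dvdn_mull // bit_block //.
case: (ltnP r.+1 15) => ltr1; last by have -> : r = 14 by lia.
rewrite -addnS bit_block //.
by move: ltr ltr1; do 15!case: r => [|r] //=.
Qed.

Lemma letter_inj x y :
  (forall r, r < 15 -> bit (x * 15 + r) = bit (y * 15 + r)) ->
  letter x = letter y.
Proof.
move=> eq_xy; have := letter_lt x; have := letter_lt y.
suff : letter x = letter y %[mod 2 ^ 6] by move=> + *; rewrite !modn_small.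
apply: eq_mod_bits => u ltu; have := eq_xy (3 + u.*2).
rewrite !bit_block; try lia.
rewrite /code_bit addKn doubleK oddD odd_double /=; apply; lia.
Qed.

Lemma zimin_at_decode {n a l} : zimin_at bit (n + 5) a l ->
  zimin_at letter n.+1 ((a + 14) %/ 15) ((a + l) %/ 15 - (a + 14) %/ 15).
Proof.
elim: n l => [|n IHn] l Z /=.
  have := zimin_at_size Z => sz; rewrite add0n /= in sz.
  by exists 0, ((a + l) %/ 15 - (a + 14) %/ 15); split=> //; lia.
case: Z => l' [d [lt_l'd lE Z eq_ad]].
have sz : 32 <= l'.+1.
  by apply: leq_trans (zimin_at_size Z); rewrite (@leq_pexp2l 2 5) ?leq_addl.
have eq_at t : a <= t -> t < a + l' -> bit t = bit (t + d).
  move=> le lt; have := eq_ad (t - a) ltac:(lia).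
  by rewrite addnAC subnKC.
set a' := (a + 14) %/ 15.
have a'E : a <= a' * 15 < a + 15 by lia.
(* The marker 00 of the first full block reappears at distance [d]. *)
have /dvdnP[e dE] : 15 %| d.
  rewrite -(@dvdn_addr (a' * 15)) ?dvdn_mull //.
  have code0 r : r < 2 -> ~~ bit (a' * 15 + r).
    by case: r => [|[|//]] _; rewrite bit_block.
  have := code0 0 isT; have := code0 1 isT; rewrite addn0 addn1.
  rewrite (eq_at (a' * 15)) ?(eq_at (a' * 15).+1) ?addSn; try lia.
  by move=> b1 b0; apply: bit_sync.
exists ((a + l') %/ 15 - a'), e; split; try lia.
  exact: IHn.
move=> r ltr; apply: letter_inj => i lti.
rewrite eq_at; try lia.
by congr bit; lia.
Qed.

Lemma tower_le_period k : tower (k + 2) <= 2 * period k.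
Proof.
case: k => [//|k]; have -> : k.+1 + 2 = k + 3 by lia.
rewrite [period _]/= /nblocks.
have := period_gt k; move: (tower _) => T; nia.
Qed.

(** Below [2 * period k] every factor is a window of level [k]. *)
Lemma bit_avoids k a l : a + l < tower (k + 2) -> ~ zimin_at bit (k + 6) a l.
Proof.
have -> : k + 6 = k.+1 + 5 by lia.
move=> lt_al /zimin_at_decode; apply: window_avoids => c ac.
have c0 : 0 < c by case: c ac => //; rewrite mul0n.
have := tower_le_period k; have := period_gt k.
have : 2 * period k <= c.+1 * period k.
  by rewrite leq_mul2r ltnS c0 orbT.
lia.
Qed.

Theorem theorem1p2 (n : nat) (hn : 5 <= n) : tower (n - 4) <= zimin_f n 2.
Proof.
have [spec _] := zimin_f_spec n 2; rewrite leqNgt; apply/negP => ltf.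
pose s t : 'I_2 := inord (bit t).
have [a [l [le_al Z]]] :=
  contains_mkseq (spec [tuple of mkseq s (zimin_f n 2)]).
have {}Z : zimin_at bit n a l.
  elim: (n) l Z {le_al} => //= m IHm l [l' [d [? ? /IHm Z' eq_s]]].
  exists l', d; split=> // r /eq_s /(congr1 val).
  by rewrite /= !inordK ?ltnS ?leq_b1 //; do 2!case: bit.
case: (ltnP 5 n) => [lt5n|le_n5].
  apply: (@bit_avoids (n - 6) a l); last by rewrite subnK.
  have -> : n - 6 + 2 = n - 4 by lia.
  exact: leq_ltn_trans le_al ltf.
(* Here the tower is 2, while an image of [Z_5] has length at least 31. *)
have n5 : n = 5 by lia.
by have := zimin_at_size Z; rewrite n5 in ltf le_al *; rewrite /= in ltf *; lia.
Qed.
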